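(* Let $r\ge 2$ and let $\mathcal{F}$ be a family of tightly connected $r$-graphs such that $\mathrm{ex}(n,\mathcal{F})=\Omega(n^{r-\gamma})$ for some $\gamma>0$. If $H$ is an $r$-graph with maximum $(r-1)$-degree at most $D\ge 1$, then $$\mathrm{ex}(H,\mathcal{F})=\Omega(D^{-\gamma})\cdot e(H),$$ where the implied constant does not depend on $H$ or $D$.
   Context: An $r$-graph is an $r$-uniform hypergraph. For a family $\mathcal{F}$ of $r$-graphs, $\mathrm{ex}(n,\mathcal{F})$ is the maximum number of edges in an $n$-vertex $r$-graph containing no member of $\mathcal{F}$ as a subgraph, and $\mathrm{ex}(H,\mathcal{F})$ is the maximum number of edges in a subgraph of $H$ containing no member of $\mathcal{F}$. The $(r-1)$-degree of an $(r-1)$-set $S$ of vertices is the number of edges containing $S$. An $r$-partite $r$-graph $F$ with $r$-partition $U_1\cup\cdots\cup U_r$ (every edge meets each $U_i$ in exactly one vertex) is tightly connected if for every $i$ and all distinct $u_1,u_2\in U_i$ there are edges $e_1,e_2$ of $F$ with $u_1\in e_1$, $u_2\in e_2$ and $|e_1\cap e_2|=r-1$. *)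

(* Defs.v *)
From mathcomp Require Import all_boot all_order all_algebra.
From mathcomp Require Import all_classical all_reals all_analysis.

Set Implicit Arguments.
Unset Strict Implicit.
Unset Printing Implicit Defensive.

Record uhypergraph (r : nat) := UHypergraph {
  vertex : finType;
  edges : {set {set vertex}};
  edges_uniform : forall e, e \in edges -> #|e| = r
}.

(* Subgraphs are taken up to isomorphism: G contains a copy of F, not
   necessarily induced or spanning. *)
Definition subgraph (r : nat) (F G : uhypergraph r) : Prop :=
  exists2 f : vertex F -> vertex G,
    injective f & forall e, e \in edges F -> f @: e \in edges G.

Definition family_free (r : nat) (Fam : uhypergraph r -> Prop)
    (G : uhypergraph r) : Prop :=
  forall F, Fam F -> ~ subgraph F G.

(* The ranges of k below lose nothing: an n-vertex r-graph has at most 'C(n, r)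
   edges, and a subgraph of H has at most #|edges H| edges. Over an empty set
   of candidates (possible only if Fam has an edgeless member) the maximum
   is 0. *)
Definition ex_vertices (r : nat) (n : nat) (Fam : uhypergraph r -> Prop) : nat :=
  \max_(k < 'C(n, r).+1 |
      `[< exists G : uhypergraph r,
            [/\ #|vertex G| = n, family_free Fam G & #|edges G| = k] >]) k.

Definition ex_subgraph (r : nat) (H : uhypergraph r)
    (Fam : uhypergraph r -> Prop) : nat :=
  \max_(k < #|edges H|.+1 |
      `[< exists G : uhypergraph r,
            [/\ subgraph G H, family_free Fam G & #|edges G| = k] >]) k.

Definition set_degree (r : nat) (H : uhypergraph r) (S : {set vertex H}) : nat :=
  #|[set e in edges H | S \subset e]|.

(* The r-partition is encoded by the map part sending a vertex of U_i to i. *)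
Definition is_rpartition (r : nat) (F : uhypergraph r)
    (part : vertex F -> 'I_r) : Prop :=
  forall e, e \in edges F -> forall i : 'I_r, #|[set x in e | part x == i]| = 1.

Definition tightly_connected (r : nat) (F : uhypergraph r) : Prop :=
  exists2 part : vertex F -> 'I_r,
    is_rpartition part &
    forall u1 u2 : vertex F, part u1 = part u2 -> u1 <> u2 ->
      exists e1 e2 : {set vertex F},
        [/\ e1 \in edges F, e2 \in edges F, u1 \in e1, u2 \in e2
          & #|e1 :&: e2| = r.-1].

(* Main.v *)
(* Let J be a dense Fam-free r-graph on n = O(D) vertices with n >= 2rD, and
   let J' be the edges of J that are rainbow for a suitable colouring of its
   vertices with r colours, so e(J') >= r^-r e(J). Map V(H) to V(J) uniformly
   at random by chi and keep an edge e of H if chi(e) is an edge of J' and no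
   edge e - u + v of H has chi(u) = chi(v); there are at most rD such swaps,
   each bad with probability 1/n, so half of the edges mapped to J' survive.
   If F is tightly connected and embeds in the kept graph, chi is injective on
   F: on a class of F by the swap condition, and across classes because the
   colour of chi(u) depends only on the class of u, bijectively. Hence F would
   embed in J. *)
Require Import Defs.
From mathcomp Require Import all_boot all_order all_algebra.
From mathcomp Require Import all_classical all_reals all_analysis.
From mathcomp Require Import ring lra.
Import Order.TTheory GRing.Theory Num.Theory.
Local Open Scope ring_scope.

(** * Counting maps, and averaging *)

(** Values on [A] are forced and the others are free; the product form avoids subtracting
    exponents. *)
Lemma card_extensions {T U : finType} (A : {set T}) (g : T -> U) :
  (#|[set f : {ffun T -> U} | [forall x in A, f x == g x]]| * #|U| ^ #|A|
   = #|U| ^ #|T|)%N.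
Proof.
pose F x : pred U := if x \in A then pred1 (g x) else predT.
have -> : #|[set f : {ffun T -> U} | [forall x in A, f x == g x]]| =
          #|(family F : pred {ffun T -> U})|.
  apply: eq_card => f; rewrite inE.
  apply/forall_inP/familyP => [h x|h x xA].
    by rewrite /F; case: ifP => // xA; rewrite inE; apply: h.
  by have := h x; rewrite /F xA inE.
rewrite card_family foldrE big_map big_enum /=.
rewrite (bigID (mem A)) /= big1 => [|x xA]; last by rewrite /F xA card1.
rewrite mul1n (eq_bigr (fun=> #|U|)) => [|x /negbTE xA]; last by rewrite /F xA.
rewrite prod_nat_const -expnD; congr (_ ^ _)%N.
have -> : #|[pred x | x \notin A]| = #|~: A| by apply: eq_card => x; rewrite !inE.
by rewrite addnC cardsC.
Qed.

Lemma exists_image_eq {T U : finType} (A : {set T}) (B : {set U}) (u0 : U) :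
  #|A| = #|B| -> exists g : T -> U, g @: A = B.
Proof.
move=> cAB; exists (fun x => nth u0 (enum B) (index x (enum A))).
apply/setP => y; apply/imsetP/idP => [[x xA ->]|yB].
  by rewrite -mem_enum mem_nth // -cardE -cAB cardE index_mem mem_enum.
have iy : (index y (enum B) < size (enum A))%N.
  by rewrite -cardE cAB cardE index_mem mem_enum.
have /card_gt0P[x0 _] : (0 < #|A|)%N by rewrite cAB; apply/card_gt0P; exists y.
exists (nth x0 (enum A) (index y (enum B))).
  by rewrite -mem_enum mem_nth.
by rewrite index_uniq ?enum_uniq // nth_index // mem_enum.
Qed.

Lemma exists_injection {T U : finType} :
  (#|T| <= #|U|)%N -> exists f : T -> U, injective f.
Proof.
move=> TU; exists (fun x => enum_val (widen_ord TU (enum_rank x))).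
move=> x y /enum_val_inj /(congr1 val) /= /val_inj; exact: enum_rank_inj.
Qed.

(** Double count the pairs [(e, t)] with [e \in G t]: a [t] maximising [#|G t|] is at least average.
    The ratio of [a] to [b] is a lower bound for the number of [t] that catch a given [e]. *)
Lemma exists_ge_average {T U : finType} (E : {set U}) (G : T -> {set U}) (a b : nat) :
  (0 < #|T|)%N ->
  (forall e, e \in E -> (a <= b * #|[set t | e \in G t]|)%N) ->
  exists t, (#|E| * a <= #|T| * (b * #|G t|))%N.
Proof.
case/card_gt0P => t0 _ h.
case: (@arg_maxnP _ t0 predT (fun t => #|G t|)) => // t _ tmax; exists t.
rewrite -sum_nat_const.
apply: (@leq_trans (\sum_(e in E) b * #|[set t | e \in G t]|)%N).
  exact: leq_sum.
rewrite -big_distrr /= mulnCA leq_mul2l; apply/orP; right.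
apply: (@leq_trans (\sum_(s : T) #|G s|)%N); last first.
  by rewrite -sum_nat_const; apply: leq_sum => s _; apply: tmax.
rewrite (eq_bigr (fun e => \sum_(s | e \in G s) 1)%N) => [|e _]; last first.
  by rewrite sum1dep_card.
rewrite (exchange_big_dep predT) //=; apply: leq_sum => s _.
rewrite sum1dep_card; apply: subset_leq_card.
by apply/fintype.subsetP => e; rewrite inE => /andP[].
Qed.

(** * Rainbow edges and the kept graph *)

Definition rainbow_edges {r : nat} (J : uhypergraph r)
    (rho : {ffun vertex J -> 'I_r}) : {set {set vertex J}} :=
  [set j in edges J | rho @: j == [set: 'I_r]].

(** The colourings that agree on an edge with one fixed bijection onto the colours already make up a
    proportion [r ^ -r] of all; then average. *)
Lemma exists_rainbow {r : nat} (J : uhypergraph r) : (0 < r)%N ->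
  exists rho : {ffun vertex J -> 'I_r},
    (#|edges J| <= r ^ r * #|rainbow_edges J rho|)%N.
Proof.
move=> r0; have i0 : 'I_r by exists 0%N.
have T0 : (0 < #|{ffun vertex J -> 'I_r}|)%N.
  by rewrite card_ffun card_ord expn_gt0 r0.
case: (exists_ge_average (edges J) (rainbow_edges J)
        (#|{ffun vertex J -> 'I_r}|) (r ^ r)%N T0) => [j jJ|rho].
  have [g gj] : exists g : vertex J -> 'I_r, g @: j = [set: 'I_r].
    apply: exists_image_eq => //; by rewrite (edges_uniform jJ) cardsT card_ord.
  rewrite card_ffun -(card_extensions j g) card_ord (edges_uniform jJ) mulnC.
  rewrite leq_mul2l; apply/orP; right; apply: subset_leq_card.
  apply/fintype.subsetP => f; rewrite !inE jJ /= => /forall_inP fg.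
  by rewrite -gj; apply/eqP/eq_in_imset => x xj; apply/eqP/fg.
by rewrite mulnC leq_pmul2l // => ?; exists rho.
Qed.

(* [v |: (e :\ u)] runs over the edges meeting [e] in [r.-1] vertices. *)
Definition kept_edges {r : nat} {H J : uhypergraph r} (J' : {set {set vertex J}})
    (chi : {ffun vertex H -> vertex J}) : {set {set vertex H}} :=
  [set e in edges H | (chi @: e \in J') &&
    [forall u in e, forall v, (v \notin e) ==> (v |: (e :\ u) \in edges H) ==>
       (chi u != chi v)]].

Lemma kept_edges_uniform {r : nat} {H J : uhypergraph r}
    (J' : {set {set vertex J}}) (chi : {ffun vertex H -> vertex J}) e :
  e \in kept_edges J' chi -> #|e| = r.
Proof. by rewrite inE => /andP[/edges_uniform]. Qed.

Definition kept_graph {r : nat} {H J : uhypergraph r} (J' : {set {set vertex J}})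
    (chi : {ffun vertex H -> vertex J}) : uhypergraph r :=
  UHypergraph (kept_edges_uniform J' chi).

(** * Counting the maps that keep a given edge *)

(** Outside [e], the vertex [v] is determined by [v |: (e :\ u)], which contains [e :\ u]. *)
Lemma card_swaps {r : nat} (H : uhypergraph r) (e : {set vertex H}) u :
  (#|[set v | (v \notin e) && (v |: (e :\ u) \in edges H)]| <=
   set_degree (e :\ u))%N.
Proof.
rewrite -(@card_in_imset _ _ (fun v => v |: (e :\ u))).
  apply: subset_leq_card; apply/fintype.subsetP => _ /imsetP[v + ->].
  by rewrite !inE => /andP[_ ->]; apply: finset.subsetUr.
move=> v w; rewrite !inE => /andP[ve _] /andP[we _] /setP/(_ v).
by rewrite !inE eqxx (negbTE ve) andbF !orbF => /esym/eqP.
Qed.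

(** Union bound over at most [r * d] swaps: a collision of [u] and [v] forces [chi v = g u], so
    [chi] is prescribed on the [r.+1] vertices of [v |: e]. *)
Lemma card_bad_maps {r : nat} {H : uhypergraph r} (W : finType) (d : nat)
    (e : {set vertex H}) (g : vertex H -> W) :
  (forall S : {set vertex H}, #|S| = r.-1 -> (set_degree S <= d)%N) ->
  e \in edges H ->
  (#|[set chi : {ffun vertex H -> W} | [forall x in e, chi x == g x] &&
      [exists u in e, exists v, [&& v \notin e, v |: (e :\ u) \in edges H
        & chi u == chi v]]]| * #|W| ^ r.+1
   <= r * d * #|W| ^ #|vertex H|)%N.
Proof.
move=> degH eH; have ce := edges_uniform eH.
pose swaps u := [set v | (v \notin e) && (v |: (e :\ u) \in edges H)].
pose ext u v := [set chi : {ffun vertex H -> W} |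
  [forall x in v |: e, chi x == (if x == v then g u else g x)]].
set B := [set _ | _].
have BE : B \subset \bigcup_(u in e) \bigcup_(v in swaps u) ext u v.
  apply/fintype.subsetP => chi; rewrite inE => /andP[/forall_inP eg].
  case/exists_inP => u ue /existsP[v /and3P[ve vH /eqP uv]].
  apply/finset.bigcupP; exists u => //; apply/finset.bigcupP; exists v.
    by rewrite inE ve.
  rewrite inE; apply/forall_inP => x; rewrite !inE => /orP[/eqP->|xe].
    by rewrite eqxx -uv eg.
  case: (x =P v) => [xv|_]; last exact: eg.
  by rewrite -xv xe in ve.
have cext u v : v \in swaps u -> (#|ext u v| * #|W| ^ r.+1 = #|W| ^ #|vertex H|)%N.
  rewrite inE => /andP[ve _].
  rewrite -(card_extensions (v |: e) (fun x => if x == v then g u else g x)).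
  by rewrite cardsU1 ve ce.
have bigU (I : finType) (A : {set I}) (F : I -> {set {ffun vertex H -> W}}) :
    (#|\bigcup_(i in A) F i| <= \sum_(i in A) #|F i|)%N.
  elim/big_rec2: _ => [|i m X _ IH]; first by rewrite cards0.
  exact: leq_trans (leq_card_setU _ _) (leq_add (leqnn _) IH).
apply: (@leq_trans ((\sum_(u in e) \sum_(v in swaps u) #|ext u v|) * #|W| ^ r.+1)%N).
  rewrite leq_mul2r; apply/orP; right.
  apply: leq_trans (subset_leq_card BE) _; apply: leq_trans (bigU _ _ _) _.
  by apply: leq_sum => u _; apply: bigU.
rewrite big_distrl /= -[X in (_ <= X * d * _)%N]ce -mulnA -sum_nat_const; apply: leq_sum => u ue.
rewrite big_distrl /=.
rewrite (eq_bigr (fun=> #|W| ^ #|vertex H|)%N) => [|v /cext //].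
rewrite sum_nat_const leq_mul2r; apply/orP; right.
apply: leq_trans (card_swaps _ _ _) (degH _ _).
by rewrite -[in RHS]ce [in RHS](cardsD1 u) ue.
Qed.

(** Split the keeping maps by the image [j] of [e]. One [g] with [g @: e = j] suffices for each [j]:
    of the maps [X] agreeing with [g] on [e], the bad ones [Y] are at most half, as [2 * (r * d)] is
    at most the number of vertices of [J]. *)
Lemma card_keeping_maps {r : nat} {H J : uhypergraph r} (d : nat)
    (J' : {set {set vertex J}}) (e : {set vertex H}) :
  (0 < #|vertex J|)%N -> (2 * (r * d) <= #|vertex J|)%N ->
  J' \subset edges J ->
  (forall S : {set vertex H}, #|S| = r.-1 -> (set_degree S <= d)%N) ->
  e \in edges H ->
  (#|J'| * #|vertex J| ^ #|vertex H| <=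
   2 * #|vertex J| ^ r * #|[set chi | e \in kept_edges J' chi]|)%N.
Proof.
set n := #|vertex J|; set N := (n ^ _)%N => n0 hn sJ degH eH.
have ce := edges_uniform eH.
set K := [set chi | _].
have -> : #|K| = (\sum_(j in J') #|[set chi in K | chi @: e == j]|)%N.
  rewrite -sum1_card (partition_big (fun chi : {ffun _ -> _} => chi @: e) (mem J')).
    by apply: eq_bigr => j _; rewrite sum1dep_card.
  by move=> chi; rewrite !inE => /and3P[].
rewrite big_distrr /= -sum_nat_const; apply: leq_sum => j jJ'.
have jJ := fintype.subsetP sJ _ jJ'.
have /card_gt0P[w0 _] := n0.
have [g gj] : exists g : vertex H -> vertex J, g @: e = j.
  by apply: exists_image_eq => //; rewrite ce (edges_uniform jJ).
pose X := [set chi : {ffun vertex H -> vertex J} | [forall x in e, chi x == g x]].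
pose Y := [set chi : {ffun vertex H -> vertex J} | [forall x in e, chi x == g x] &&
  [exists u in e, exists v, [&& v \notin e, v |: (e :\ u) \in edges H
    & chi u == chi v]]].
have cX : (#|X| * n ^ r = N)%N by rewrite -[X in (_ ^ X)%N]ce card_extensions.
have cY : (#|Y| * n ^ r.+1 <= r * d * N)%N by apply: card_bad_maps.
have YN : (2 * (#|Y| * n ^ r) <= N)%N.
  rewrite -(leq_pmul2l n0); apply: leq_trans (leq_mul hn (leqnn N)).
  by rewrite mulnCA -[leqRHS]mulnA leq_mul2l /= mulnCA -expnS.
have XY : (#|X| <= #|Y| + #|[set chi in K | chi @: e == j]|)%N.
  apply: leq_trans (leq_card_setU _ _); apply: subset_leq_card.
  apply/fintype.subsetP => chi; rewrite !inE => cg; rewrite cg /=.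
  have -> : chi @: e = j.
    by rewrite -gj; apply: eq_in_imset => x xe; apply/eqP/(forall_inP cg).
  rewrite eqxx eH jJ' /= andbT; apply/orP.
  case: (boolP [exists _ in _, _]) => [|ne]; [by left|right].
  apply/forall_inP => u ue; apply/forallP => v; apply/implyP => ve.
  apply/implyP => vH; apply: contra ne => uv.
  by apply/exists_inP; exists u => //; apply/existsP; exists v; rewrite ve vH uv.
(* Scaling [XY] by [2 * n ^ r] gives [2 * N] on the left, and by [YN] the part from [Y] is at most
   [N]; cancel [N]. *)
have := leq_mul (leqnn (2 * n ^ r)%N) XY.
rewrite mulnDr -!mulnA ![(n ^ r * _)%N]mulnC cX => h.
by rewrite -(leq_add2l N) addnn -mul2n (leq_trans h) // leq_add2r.
Qed.

(** * Freeness of the kept graph *)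

(** Translates the intersection condition of tight connectivity into the swap form of [kept_edges];
    both inclusions become equalities by cardinality. *)
Lemma swap_of_adjacent {T : finType} {e1 e2 : {set T}} {x1 x2 : T} :
  x1 \in e1 -> x2 \notin e1 -> x2 \in e2 -> x1 \notin e2 ->
  #|e1 :&: e2| = #|e1|.-1 -> #|e2| = #|e1| -> e2 = x2 |: (e1 :\ x1).
Proof.
move=> x1e x2e x2e2 x1e2 cI ce.
have cD : #|e1 :\ x1| = #|e1|.-1 by rewrite [in RHS](cardsD1 x1) x1e.
have E : e1 :&: e2 = e1 :\ x1.
  apply/eqP; rewrite eqEcard cI cD leqnn andbT.
  apply/fintype.subsetP => y; rewrite !inE => /andP[-> ye2].
  by rewrite andbT; apply: contraNneq x1e2 => <-.
apply/esym/eqP; rewrite eqEcard -E; apply/andP; split.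
  apply/fintype.subsetP => y; rewrite !inE => /orP[/eqP->//|/andP[]//].
rewrite cardsU1 !inE (negbTE x2e) /= cI ce add1n prednK //.
by apply/card_gt0P; exists x1.
Qed.

Lemma kept_graph_free {r : nat} {Fam : uhypergraph r -> Prop}
    {H J : uhypergraph r} {rho : {ffun vertex J -> 'I_r}}
    {chi : {ffun vertex H -> vertex J}} :
  (forall F : uhypergraph r, Fam F -> tightly_connected F) ->
  (r <= #|vertex J|)%N -> family_free Fam J ->
  family_free Fam (kept_graph (rainbow_edges J rho) chi).
Proof.
move=> hFam rn freeJ F FF [f finj fE]; apply: (freeJ F FF).
have [part partF tight] := hFam F FF.
have partI e i x y : e \in edges F -> x \in e -> y \in e ->
    part x = i -> part y = i -> x = y.
  move=> eF xe ye px py.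
  have /eqP/cards1P[z Ez] := partF e eF i.
  have: x \in [set x in e | part x == i] by rewrite inE xe px eqxx.
  have: y \in [set x in e | part x == i] by rewrite inE ye py eqxx.
  by rewrite Ez !inE => /eqP-> /eqP->.
(* Without edges, tightness leaves at most one vertex per class, so [F] has at most [r] vertices and
   any injection embeds it in [J]. *)
have [F0|[e0 e0F]] := set_0Vmem (edges F).
  have pinj : injective part.
    move=> x y pxy; apply: contrapT => xy.
    by have [e1 [e2 []]] := tight x y pxy xy; rewrite F0 inE.
  have [h hinj] : exists h : vertex F -> vertex J, injective h.
    by apply: exists_injection; apply: leq_trans rn; rewrite -[leqRHS]card_ord (leq_card part).
  by exists h => // e; rewrite F0 inE.
pose h x := chi (f x).
have hE e : e \in edges F -> h @: e \in rainbow_edges J rho.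
  move=> eF; have := fE e eF; rewrite /= inE => /and3P[_ + _].
  by rewrite -imset_comp.
have rinj e : e \in edges F -> {in e &, injective (fun x => rho (h x))}.
  move=> eF; apply/imset_injP; have := hE e eF; rewrite inE => /andP[_ /eqP].
  rewrite -imset_comp => E.
  by rewrite (edges_uniform eF) -[eqbRHS]card_ord -cardsT -E.
(* Since [e1] and its swap [e2] are both rainbow, [x2] must take the colour that [x1] had; the
   images differ by the swap condition on the kept edge [f @: e1]. *)
have adj x1 x2 : part x1 = part x2 -> x1 <> x2 ->
    rho (h x1) = rho (h x2) /\ h x1 <> h x2.
  move=> p12 n12; have [e1 [e2 [e1F e2F x1e x2e cI]]] := tight x1 x2 p12 n12.
  have x2e1 : x2 \notin e1.
    by apply/negP => x2e1; apply: n12; apply: (partI e1) p12 erefl.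
  have x1e2 : x1 \notin e2.
    by apply/negP => x1e2; apply: n12; apply: (partI e2) p12 erefl.
  have E : e2 = x2 |: (e1 :\ x1).
    by apply: swap_of_adjacent; rewrite ?(edges_uniform e1F) ?(edges_uniform e2F).
  split.
    have: rho (h x1) \in [set rho (h x) | x in e2].
      have := hE e2 e2F; rewrite inE => /andP[_ /eqP].
      by rewrite -imset_comp => ->; rewrite inE.
    case/imsetP => y; rewrite E !inE => /orP[/eqP->//|/andP[yx1 ye1]] ry.
    by rewrite (rinj e1 e1F _ _ x1e ye1 ry) eqxx in yx1.
  have := fE e1 e1F; rewrite /= inE => /and3P[_ _ /forall_inP/(_ (f x1))].
  rewrite imset_f // => /(_ isT)/forallP/(_ (f x2)).
  rewrite mem_imset // x2e1 /=.
  have -> : f x2 |: (f @: e1 :\ f x1) = f @: e2.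
    rewrite E finset.imsetU1 -[in LHS](finset.setD1K x1e) finset.imsetU1.
    by rewrite finset.setU1K // mem_imset // !inE eqxx.
  by have := fE e2 e2F; rewrite /= inE => /andP[-> _] /= /eqP.
(* The edge [e0] serves as reference: it meets every class, and its vertices have distinct
   colours. *)
have meet x : exists2 y, y \in e0 & part y = part x /\ rho (h y) = rho (h x).
  have /eqP/cards1P[y Ey] := partF e0 e0F (part x).
  have: y \in [set y in e0 | part y == part x] by rewrite Ey inE.
  rewrite inE => /andP[ye /eqP pyx]; exists y => //; split=> //.
  by have [->//|/eqP yx] := eqVneq y x; have [] := adj y x pyx yx.
exists h => [x1 x2 h12|e eF]; last by have := hE e eF; rewrite inE => /andP[].
(* Equal images have equal colours, hence the same representative in [e0] and the same class, where
   [adj] separates them. *)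
apply: contrapT => n12.
have [y1 y1e [p1 r1]] := meet x1; have [y2 y2e [p2 r2]] := meet x2.
have y12 : y1 = y2 by apply: (rinj e0) => //; rewrite r1 r2 h12.
by have [] := adj x1 x2 _ n12; rewrite // -p1 -p2 y12.
Qed.

(** * The dense free subgraph and the choice of parameters *)

(** Average the kept graph over all [chi]: the factor [r ^ r] is the loss to rainbow edges, and
    [2 * #|vertex J| ^ r] the cost of keeping an edge. *)
Lemma exists_dense_free_subgraph {r : nat} {Fam : uhypergraph r -> Prop}
    (H J : uhypergraph r) (d : nat) :
  (0 < r)%N -> (forall F : uhypergraph r, Fam F -> tightly_connected F) ->
  (r <= #|vertex J|)%N -> (2 * (r * d) <= #|vertex J|)%N -> family_free Fam J ->
  (forall S : {set vertex H}, #|S| = r.-1 -> (set_degree S <= d)%N) ->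
  exists G : uhypergraph r, [/\ subgraph G H, family_free Fam G &
    (#|edges H| * #|edges J| <= 2 * r ^ r * #|vertex J| ^ r * #|edges G|)%N].
Proof.
move=> r0 hFam rn dn freeJ degH; have n0 := leq_trans r0 rn.
have [rho crho] := exists_rainbow J r0.
have T0 : (0 < #|{ffun vertex H -> vertex J}|)%N by rewrite card_ffun expn_gt0 n0.
have sJ : rainbow_edges J rho \subset edges J.
  by apply/fintype.subsetP => j; rewrite inE => /andP[].
have [chi] := exists_ge_average (edges H) _ _ _ T0
  (fun e => card_keeping_maps d (rainbow_edges J rho) e n0 dn sJ degH).
rewrite card_ffun mulnA [leqLHS]mulnC leq_pmul2l ?expn_gt0 ?n0 // => hchi.
exists (kept_graph (rainbow_edges J rho) chi); split.
- exists id => // e; rewrite imset_id inE => /andP[]//.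
- exact: kept_graph_free.
apply: (@leq_trans (#|edges H| * (r ^ r * #|rainbow_edges J rho|))%N).
  by rewrite leq_mul2l crho orbT.
rewrite [leqLHS]mulnCA [(2 * r ^ r)%N]mulnC -!mulnA leq_pmul2l ?expn_gt0 ?r0 //.
by rewrite mulnA.
Qed.

Lemma ex_subgraph_ge {r : nat} (H G : uhypergraph r) (Fam : uhypergraph r -> Prop) :
  subgraph G H -> family_free Fam G -> (#|edges G| <= ex_subgraph H Fam)%N.
Proof.
move=> GH freeG.
have cG : (#|edges G| < #|edges H|.+1)%N.
  case: GH => f finj fE; rewrite ltnS -(card_imset (edges G) (imset_inj finj)).
  by apply: subset_leq_card; apply/fintype.subsetP => _ /imsetP[e eG ->]; apply: fE.
apply: (@bigop.leq_bigmax_cond _ _ _ (Ordinal cG)).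
by apply/asboolP; exists G.
Qed.

(** Positivity excludes the empty set of candidates, where the default 0 is attained by no graph. *)
Lemma ex_vertices_attained {r : nat} (n : nat) (Fam : uhypergraph r -> Prop) :
  (0 < ex_vertices n Fam)%N -> exists J : uhypergraph r,
    [/\ #|vertex J| = n, family_free Fam J & #|edges J| = ex_vertices n Fam].
Proof.
pose P (k : 'I_('C(n, r).+1)) := `[< exists G : uhypergraph r,
  [/\ #|vertex G| = n, family_free Fam G & #|edges G| = k] >].
have [k Pk|P0] := pickP P; last by rewrite /ex_vertices big_pred0.
rewrite /ex_vertices (bigop.bigmax_eq_arg _ Pk).
by case: arg_maxnP => // i /asboolP.
Qed.

Theorem theorem1p4 (R : realType) (r : nat) (hr : (2 <= r)%N)
  (Fam : uhypergraph r -> Prop)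
  (hFam : forall F : uhypergraph r, Fam F -> tightly_connected F)
  (gamma : R) (hgamma : 0 < gamma)
  (hex : exists2 c : R, 0 < c &
     exists n0 : nat, forall n : nat, (n0 <= n)%N ->
       c * n%:R `^ (r%:R - gamma) <= (ex_vertices n Fam)%:R) :
  exists2 C : R, 0 < C &
    forall (H : uhypergraph r) (D : R), 1 <= D ->
      (forall S : {set vertex H}, #|S| = r.-1 -> (set_degree S)%:R <= D) ->
      C * D `^ (- gamma) * #|edges H|%:R <= (ex_subgraph H Fam)%:R.
Proof.
have r0 : (0 < r)%N by apply: leq_trans hr.
case: hex => c c0 [n0 hn0].
(* [K] is chosen so that [n <= K * D] below; [M] is the constant lost in
   [exists_dense_free_subgraph]. *)
pose K : R := (n0 + 3 * r)%:R; pose M := (2 * r ^ r)%N.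
have K0 : 0 < K by rewrite ltr0n addn_gt0 muln_gt0 r0 orbT.
have M0 : 0 < M%:R :> R by rewrite ltr0n muln_gt0 expn_gt0 r0.
exists (c * K `^ (- gamma) / M%:R).
  by rewrite divr_gt0 // mulr_gt0 // powR_gt0.
move=> H D D1 degH.
have D0 : 0 < D by apply: lt_le_trans D1.
pose d := Num.truncn D.
have dD : d%:R <= D by rewrite truncn_le ltW.
(* The summands put [n] in the range of [hex], leave room for edgeless members, and make bad swaps
   cost at most half. *)
pose n := (n0 + r + 2 * (r * d))%N.
have ngt0 : 0 < n%:R :> R by rewrite ltr0n /n -addnA addnCA addn_gt0 r0.
have nKD : n%:R <= K * D.
  (* [K * D - n] is the first two products plus twice the third. *)
  have h0 : 0 <= n0%:R * (D - 1) by rewrite mulr_ge0 ?subr_ge0.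
  have h1 : 0 <= r%:R * (D - 1) by rewrite mulr_ge0 ?subr_ge0.
  have h2 : 0 <= r%:R * (D - d%:R) by rewrite mulr_ge0 ?subr_ge0.
  by rewrite /n /K !natrD !natrM; lra.
have exn : c * n%:R `^ (r%:R - gamma) <= (ex_vertices n Fam)%:R.
  by apply: hn0; rewrite /n -addnA leq_addr.
have [J [Jn freeJ Jex]] : exists J : uhypergraph r,
    [/\ #|vertex J| = n, family_free Fam J & #|edges J| = ex_vertices n Fam].
  apply: ex_vertices_attained; rewrite -(ltr0n R); apply: lt_le_trans exn.
  by rewrite mulr_gt0 // powR_gt0.
have rJ : (r <= #|vertex J|)%N by rewrite Jn /n addnAC leq_addl.
have dJ : (2 * (r * d) <= #|vertex J|)%N by rewrite Jn /n leq_addl.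
have degd (S : {set vertex H}) : #|S| = r.-1 -> (set_degree S <= d)%N.
  by rewrite /d truncn_ge_nat ?(ltW D0) //; apply: degH.
have [G [GH freeG]] := exists_dense_free_subgraph H J d r0 hFam rJ dJ freeJ degd.
rewrite Jn Jex => hG0.
have hG : #|edges H|%:R * (ex_vertices n Fam)%:R <=
    M%:R * n%:R ^+ r * #|edges G|%:R :> R by rewrite -natrX -!natrM ler_nat.
apply: (@le_trans _ _ #|edges G|%:R); last by rewrite ler_nat ex_subgraph_ge.
have hpow : K `^ (- gamma) * D `^ (- gamma) <= n%:R `^ (- gamma).
  rewrite -powRM ?(ltW K0) ?(ltW D0) // !powRN lef_pV2 ?posrE ?powR_gt0 ?mulr_gt0 //.
  by rewrite ge0_ler_powR ?nnegrE ?mulr_ge0 // ltW.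
have nr0 : 0 < n%:R ^+ r :> R by rewrite exprn_gt0.
have -> : c * K `^ (- gamma) / M%:R * D `^ (- gamma) * #|edges H|%:R =
    (c * (K `^ (- gamma) * D `^ (- gamma)) * #|edges H|%:R) / M%:R by ring.
(* With the factor [n ^ r] on both sides, [n ^ r * n ^ (- gamma)] matches the lower bound [exn], and
   [hG] bounds the result by [M * n ^ r * #|edges G|]. *)
rewrite ler_pdivrMr // -(ler_pM2l nr0).
apply: (@le_trans _ _ (#|edges H|%:R * (ex_vertices n Fam)%:R)); last first.
  by apply: le_trans hG _; rewrite le_eqVlt; apply/orP/or_introl/eqP; ring.
apply: (@le_trans _ _ (#|edges H|%:R * (c * n%:R `^ (r%:R - gamma)))); last first.
  exact: ler_wpM2l.
rewrite powRD ?(gt_eqF ngt0) ?implybT // powR_mulrn //.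
have -> : n%:R ^+ r * (c * (K `^ (- gamma) * D `^ (- gamma)) * #|edges H|%:R) =
  #|edges H|%:R * (c * (n%:R ^+ r * (K `^ (- gamma) * D `^ (- gamma)))) by ring.
by rewrite ler_wpM2l // ler_pM2l // ler_pM2l.
Qed.
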